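(* For every $n\ge 5$, $\mu(M(P_n))=n+\left\lfloor \frac{n+1}{4}\right\rfloor$, where $P_n$ is the path on $n$ vertices.
   Context: All graphs are finite and simple. The Mycielskian $M(G)$ of a graph $G$ has vertex set $V(G)\cup V(G')\cup\{v^*\}$, where $V(G')=\{u': u\in V(G)\}$, and edge set $E(G)\cup\{uv': uv\in E(G)\}\cup\{v'v^*: v'\in V(G')\}$ (so for each edge $uv$ of $G$ both $uv'$ and $vu'$ are edges). Given $S\subseteq V(H)$, two vertices $x,y$ are $S$-visible if some shortest $x,y$-path in $H$ has no internal vertex in $S$; $S$ is a mutual-visibility set if every two vertices of $S$ are $S$-visible; $\mu(H)$ is the maximum size of a mutual-visibility set of $H$. *)

(* Defs.v *)
From mathcomp Require Import all_boot.

Set Implicit Arguments.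
Unset Strict Implicit.
Unset Printing Implicit Defensive.

Record sgraph := SGraph {
  vertex :> finType;
  adj : rel vertex;
  adj_sym : symmetric adj;
  adj_irr : irreflexive adj }.

Section MutualVisibility.
Variable H : sgraph.
Implicit Types (x y : H) (p : seq H) (S : {set H}).

(* As in path.v, x :: p is the vertex sequence and size p the length. *)
Definition is_path x y p : bool :=
  [&& path (@adj H) x p, last x p == y & uniq (x :: p)].

Definition shortest_path x y p : bool :=
  is_path x y p &&
  [forall k : 'I_(size p), forall q : k.-tuple H, ~~ is_path x y q].

Definition internal x p : seq H := behead (belast x p).

(* The bound k < #|H| loses nothing, as a path has no repeated vertex;
   see visibleP. *)
Definition visible S x y : bool :=
  [exists k : 'I_#|H|, exists p : k.-tuple H,
     shortest_path x y p && all [predC S] (internal x p)].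

Definition mutual_visibility S : bool :=
  [forall x in S, forall y in S, (x != y) ==> visible S x y].

Definition mu : nat := \max_(S : {set H} | mutual_visibility S) #|S|.

Lemma shortest_pathP x y p :
  reflect (is_path x y p /\ forall q, is_path x y q -> size p <= size q)
          (shortest_path x y p).
Proof.
apply: (iffP andP) => -[xyp min_p]; split=> //.
  move=> q xyq; rewrite leqNgt; apply/negP => lt_qp.
  by have /forallP/(_ (in_tuple q)) := forallP min_p (Ordinal lt_qp); rewrite xyq.
apply/forallP => k; apply/forallP => q; apply/negP => /min_p.
by rewrite size_tuple leqNgt ltn_ord.
Qed.

Lemma visibleP S x y :
  reflect (exists p, shortest_path x y p /\
                     forall z, z \in internal x p -> z \notin S)
          (visible S x y).
Proof.
apply: (iffP existsP) => [[k /existsP[p /andP[sp /allP pS]]]|[p [sp pS]]].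
  by exists p; split=> // z /pS.
have lt_p : size p < #|H|.
  case/andP: (sp) => /and3P[_ _ up] _.
  by rewrite -[(size p).+1]/(size (x :: p)) -(card_uniqP up) max_card.
exists (Ordinal lt_p); apply/existsP; exists (in_tuple p).
by rewrite /= sp; apply/allP => z /pS.
Qed.

End MutualVisibility.

Section Mycielskian.
Variable G : sgraph.

(* inl (inl u) is u, inl (inr u) is the copy u', inr tt is v^*. *)
Definition mycielskian_vertex : finType := (G + G + unit)%type.

Definition mycielskian_adj : rel mycielskian_vertex := fun x y =>
  match x, y with
  | inl (inl u), inl (inl v) => adj u v
  | inl (inl u), inl (inr v) => adj u v
  | inl (inr u), inl (inl v) => adj u v
  | inl (inr _), inr _ => true
  | inr _, inl (inr _) => true
  | _, _ => false
  end.

Lemma mycielskian_sym : symmetric mycielskian_adj.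
Proof. by move=> [[u|u]|[]] [[v|v]|[]] //=; rewrite adj_sym. Qed.

Lemma mycielskian_irr : irreflexive mycielskian_adj.
Proof. by move=> [[u|u]|[]] //=; rewrite adj_irr. Qed.

Definition mycielskian : sgraph := SGraph mycielskian_sym mycielskian_irr.

End Mycielskian.

Section PathGraph.
Variable n : nat.

Definition path_adj : rel 'I_n := fun i j => (i.+1 == j) || (j.+1 == i).

Lemma path_adj_sym : symmetric path_adj.
Proof. by move=> i j; rewrite /path_adj orbC. Qed.

Lemma path_adj_irr : irreflexive path_adj.
Proof. by move=> i; rewrite /path_adj orbb eqn_leq ltnn. Qed.

Definition path_graph : sgraph := SGraph path_adj_sym path_adj_irr.

End PathGraph.

(* Main.v *)
Require Import Defs.
From mathcomp Require Import all_boot zify.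

(** Let [A] and [B] be the sets of indices [i < n] such that [S] contains
    [u_i], respectively the copy [u'_i], and let [C] be the complement of [B].

    Suppose first that [v^*] is not in [S], so that the upper bound reads
    [|A| - |C| <= (n+1)/4].  A vertex [u_i] of [S] sees distant vertices of [S]
    only through a copy [u'_c] with [c] in [C] adjacent to [i].  If every [i]
    in [A] has such a [c], charge [i] to [i+1] if [i+1] is in [C] and to [i-1]
    otherwise.  The indices [c] that are charged twice satisfy [c-1, c+1 \in A]
    and [c+2 \notin C]; the visibility of vertices at distance 3 forces any two
    of them to be at least 4 apart, and they lie in [[1, n-2]], so there are at
    most [(n+1)/4] of them.  If some [i] in [A] has no neighbour in [C], then
    all of [S] is near [i], and on each side of [i] the set [C] is at least as
    large as [A], whence [|A| - |C| <= 1].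

    If [v^*] is in [S], then [|S| <= 6].

    The bound is attained with [A] the even numbers below [4k] and [C] the
    numbers [4t+1] below [4k], where [k = (n+1)/4]: the copy [u'_(4t+1)] serves
    both [u_(4t)] and [u_(4t+2)]. *)

Set Implicit Arguments.
Unset Strict Implicit.
Unset Printing Implicit Defensive.

Ltac bits :=
  repeat match goal with
  | H : is_true true -> _ |- _ => specialize (H isT)
  | H : _ \/ [/\ _, _ & _] |- _ => case: H => [?|[? ? ?]]
  end; done.

(** * Combinatorics of the index sets *)

Section Combinatorics.
Implicit Types (n i j k : nat) (a b c d : nat -> bool).

(** A path from [u_i] to [v^*] of length two passes through the copy of a neighbour of [i]; here one
    such copy is outside [S]. The range tests exclude [0.-1 = 0] and the index [n], where [b] would
    be false by default. *)
Definition free_nbr n b i :=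
  ((0 < i) && ~~ b i.-1) || ((i.+1 < n) && ~~ b i.+1).

(* What mutual visibility says about the indices [i] of the [u_i] ([a]) and of
   the [u'_i] ([b]) in a set that avoids [v^*].  The letters of a field name
   tell which vertices see each other, the digit is the difference of their
   indices.  Indices are given by equations so that [mirror] acts on them. *)
Record feasible n a b : Prop := Feasible {
  feas_a : forall i, a i -> i < n;
  feas_b : forall i, b i -> i < n;
  feas_aa2 : forall i k j, k = i.+1 -> j = i.+2 -> a i -> a j -> a k -> ~~ b k;
  feas_aa3 : forall i k l j, k = i.+1 -> l = i.+2 -> j = i.+3 -> a i -> a j ->
    [|| ~~ a k && ~~ a l, ~~ b k && ~~ a l | ~~ a k && ~~ b l];
  feas_aa5 : forall i j, i.+4 < j -> a i -> a j -> free_nbr n b i && free_nbr n b j;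
  feas_ab2 : forall i k j, k = i.+1 -> j = i.+2 -> a i -> b j -> ~~ a k;
  feas_ba2 : forall i k j, k = i.+1 -> j = i.+2 -> b i -> a j -> ~~ a k;
  feas_ab3 : forall i k l j, k = i.+1 -> l = i.+2 -> j = i.+3 -> a i -> b j ->
    free_nbr n b i || (~~ a k && ~~ a l);
  feas_ba3 : forall i k l j, k = i.+1 -> l = i.+2 -> j = i.+3 -> b i -> a j ->
    free_nbr n b j || (~~ a k && ~~ a l);
  feas_ab4 : forall i j, i.+3 < j -> a i -> b j -> free_nbr n b i;
  feas_ba4 : forall i j, i.+3 < j -> b i -> a j -> free_nbr n b j }.

(** Reversal of the path. The guard is needed because truncated subtraction sends every [i >= n] to
    [0]. *)
Definition mirror n a i := (i < n) && a (n.-1 - i).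

Lemma free_nbr_mirror n b i :
  i < n -> free_nbr n (mirror n b) i = free_nbr n b (n.-1 - i).
Proof.
rewrite /free_nbr /mirror => lt_in.
have [i0|i0] := posnP i; have [i1|i1] := ltnP i.+1 n.
- have [-> ->] : (0 < n.-1 - i) /\ (n.-1 - i).+1 < n = false by lia.
  by rewrite i0 /= subn1 orbF subn0.
- have [-> ->] : (0 < n.-1 - i = false) /\ (n.-1 - i).+1 < n = false by lia.
  by rewrite i0.
- have [-> ->] : (0 < n.-1 - i) /\ (n.-1 - i).+1 < n by lia.
  have -> : i.-1 < n by lia.
  have -> : (n.-1 - i).-1 = n.-1 - i.+1 by lia.
  have -> : (n.-1 - i).+1 = n.-1 - i.-1 by lia.
  by rewrite /= orbC.
- have [-> ->] : (0 < n.-1 - i = false) /\ (n.-1 - i).+1 < n by lia.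
  have -> : i.-1 < n by lia.
  have -> : (n.-1 - i).+1 = n.-1 - i.-1 by lia.
  by rewrite /= orbF.
Qed.

(** Reversal keeps the [aa] fields and exchanges each [ab] field with the corresponding [ba] field;
    the intermediate indices [k] and [l] change places. *)
Lemma feasible_mirror n a b :
  feasible n a b -> feasible n (mirror n a) (mirror n b).
Proof.
move=> F; split.
- by move=> i /andP[].
- by move=> i /andP[].
- move=> i k j ik ij /andP[li ai] /andP[lj aj] /andP[lk ak].
  by rewrite /mirror lk; apply: feas_aa2 F _ _ _ _ _ aj ai ak; lia.
- move=> i k l j ik il ij /andP[li ai] /andP[lj aj].
  have [lk ll] : k < n /\ l < n by lia.
  rewrite /mirror lk ll /=.
  have := feas_aa3 F (k := n.-1 - l) (l := n.-1 - k) _ _ _ aj ai.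
  by move=> /(_ ltac:(lia) ltac:(lia) ltac:(lia)); lia.
- move=> i j ij /andP[li ai] /andP[lj aj].
  rewrite !free_nbr_mirror // andbC.
  by apply: feas_aa5 F _ _ _ aj ai; lia.
- move=> i k j ik ij /andP[li ai] /andP[lj bj]; rewrite /mirror.
  by rewrite (negPf (feas_ba2 F (k := n.-1 - k) _ _ bj ai)) ?andbF //; lia.
- move=> i k j ik ij /andP[li bi] /andP[lj aj]; rewrite /mirror.
  by rewrite (negPf (feas_ab2 F (k := n.-1 - k) _ _ aj bi)) ?andbF //; lia.
- move=> i k l j ik il ij /andP[li ai] /andP[lj bj].
  rewrite free_nbr_mirror // /mirror.
  have := feas_ba3 F (k := n.-1 - l) (l := n.-1 - k) _ _ _ bj ai.
  by move=> /(_ ltac:(lia) ltac:(lia) ltac:(lia)); lia.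
- move=> i k l j ik il ij /andP[li bi] /andP[lj aj].
  rewrite free_nbr_mirror // /mirror.
  have := feas_ab3 F (k := n.-1 - l) (l := n.-1 - k) _ _ _ aj bi.
  by move=> /(_ ltac:(lia) ltac:(lia) ltac:(lia)); lia.
- move=> i j ij /andP[li ai] /andP[lj bj]; rewrite free_nbr_mirror //.
  by apply: feas_ba4 F _ _ _ bj ai; lia.
- move=> i j ij /andP[li bi] /andP[lj aj]; rewrite free_nbr_mirror //.
  by apply: feas_ab4 F _ _ _ aj bi; lia.
Qed.

(** * Counting in a set that avoids [v^*] *)

Definition gap n b i := (i < n) && ~~ b i.

(** The densest case is [1, 5, 9, ...], which has [(N + 2) %/ 4] members below [N]. In the
    induction, a member at the last index empties the three before it, so four terms are removed at
    the cost of one. *)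
Lemma sum_spread d :
    ~~ d 0 -> (forall i j, d i -> d j -> i < j -> i.+4 <= j) ->
  forall N, \sum_(0 <= i < N) d i <= (N + 2) %/ 4.
Proof.
move=> d0 dP; elim/ltn_ind=> -[|N] IH; first by rewrite big_geq.
rewrite big_nat_recr //=; case dN: (d N); last first.
  by have := IH N (ltnSn N); lia.
have far i : i < N -> N < i.+4 -> d i = false.
  by move=> iN Ni; apply/negP => di; have := dP _ _ di dN iN; lia.
case: N IH dN far => [|[|[|[|N]]]] IH dN far.
- by rewrite dN in d0.
- by rewrite !big_nat_recr //= big_geq // !far.
- by rewrite !big_nat_recr //= big_geq // !far.
- by rewrite !big_nat_recr //= big_geq // !far.
- do 3 rewrite big_nat_recr //=.
  rewrite (far N.+1) ?(far N.+2) ?(far N.+3) //; try lia.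
  by have := IH N.+1 ltac:(lia); lia.
Qed.

Lemma sum_charged n a b : feasible n a b -> (forall i, a i -> free_nbr n b i) ->
  \sum_(0 <= i < n) a i <= \sum_(0 <= i < n) gap n b i + (n + 1) %/ 4.
Proof.
move=> F fr; case: n F fr => [|m] F fr; first by rewrite big_geq.
pose c := gap m.+1 b.
(* [d] holds at the elements of the gap set that are charged twice. *)
pose d i := [&& 0 < i, a i.-1, a i.+1, c i & ~~ c i.+2].
have cE i : c i = (i < m.+1) && ~~ b i by [].
have le_d : \sum_(0 <= i < m.+1) d i <= (m.+1 + 1) %/ 4.
  (* [d m] would need [a m.+1], which is out of range. Without this index, [sum_spread] for [m]
     terms gives exactly the required quotient. *)
  rewrite big_nat_recr //=.
  have -> : d m = false.
    by apply/negP => /and5P[_ _ /(feas_a F)]; rewrite ltnn.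
  rewrite addn0 addn1 -addn2; apply: sum_spread => // i j.
  move=> /and5P[i0 a1 a2 ci ci2] /and5P[j0 a3 a4 cj cj2] lt_ij.
  rewrite leqNgt; apply/negP => lt_ji.
  (* For [j = i.+1], all of [i.-1, ..., i.+2] are in [A], so [u_(i-1)] and [u_(i+2)] do not see each
     other. For [j = i.+3], both [u_(i+2)] and its copy are in [S], which separates [u_(i+1)] from
     [u_(i+4)]. *)
  have [e|[e|e]] : j = i.+1 \/ j = i.+2 \/ j = i.+3 by lia.
  - move: a3 a4 cj cj2; rewrite e /= => a3 a4 cj cj2.
    have := feas_aa3 F (k := i) (l := i.+1) _ _ _ a1 a4.
    by move=> /(_ ltac:(lia) ltac:(lia) ltac:(lia)); lia.
  - by rewrite e (negPf ci2) in cj.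
  - move: a3 a4 cj cj2; rewrite e /= => a3 a4 cj cj2.
    have := feas_aa3 F (erefl i.+2) (erefl i.+3) (erefl i.+4) a2 a4.
    have := feas_a F a3; move: ci2 cj; rewrite !cE; lia.
apply: leq_trans (leq_add (leqnn _) le_d); rewrite -big_split /=.
(* [f] and [g] record the charges that [i] receives from its left and right neighbour. Below, [p]
   and [q] record the same charges at their senders, so the sums agree up to a shift by one. *)
pose f i := (0 < i) && a i.-1 && c i; pose g i := [&& a i.+1, c i & ~~ c i.+2].
apply: (@leq_trans (\sum_(0 <= i < m.+1) f i + \sum_(0 <= i < m.+1) g i)).
  pose p i := a i && c i.+1; pose q i := [&& 0 < i, a i, c i.-1 & ~~ c i.+1].
  apply: (@leq_trans (\sum_(0 <= i < m.+1) p i + \sum_(0 <= i < m.+1) q i)).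
    rewrite -big_split /=; apply: leq_sum => i _.
    have := feas_a F (i := i); have := fr i; rewrite /free_nbr /p /q !cE.
    case: (a i) => //= /(_ isT) fri /(_ isT) lti.
    case: i fri lti => [|i] /=; lia.
  have pm : p m = false by rewrite /p cE ltnn andbF.
  rewrite [\sum_(0 <= i < _) p i]big_nat_recr //= pm addn0.
  rewrite [\sum_(0 <= i < _) f i]big_nat_recl //= add0n leq_add2l.
  rewrite [\sum_(0 <= i < _) q i]big_nat_recl //= add0n.
  by rewrite [\sum_(0 <= i < _) g i]big_nat_recr //= leq_addr.
rewrite -big_split /=; apply: leq_sum => i _.
by rewrite /f /g /d -/c; case: (0 < i) => //=; lia.
Qed.

Lemma sum_nat_widen n N i (f : nat -> bool) : (forall j, f j -> j < n) ->
  i <= n -> n <= N -> \sum_(i <= j < n) f j = \sum_(i <= j < N) f j.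
Proof.
move=> fn le_in le_nN; rewrite [RHS](big_cat_nat le_in le_nN) /=.
rewrite [X in _ + X]big_nat_cond [X in _ + X]big1 ?addn0 // => j.
by rewrite andbT; case fj: (f j) => //; have := fn _ fj; lia.
Qed.

(** By [feas_aa5] no index of [A] exceeds [i.+4], so only four positions have to be compared, and
    this is a finite check. *)
Lemma sum_after n a b i : 5 <= n -> feasible n a b -> a i -> ~~ free_nbr n b i ->
  \sum_(i.+1 <= j < n) a j <= \sum_(i.+1 <= j < n) gap n b j.
Proof.
move=> n5 F ai nfr; have lt_in := feas_a F ai.
have split4 (f : nat -> bool) : (forall j, f j -> j < n) ->
    \sum_(i.+1 <= j < n) f j = f i.+1 + f i.+2 + f i.+3 + f i.+4
      + \sum_(i.+4.+1 <= j < i.+4.+1 + n) f j.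
  (* The range is extended past [n], where [f] vanishes, so that the split at [i.+4.+1] is
     legitimate even if the window overruns the path. *)
  move=> fn; rewrite (sum_nat_widen fn lt_in (N := i.+4.+1 + n)); last by lia.
  rewrite (@big_cat_nat _ _ _ i.+4.+1) /=; [|lia|lia].
  congr (_ + _); do 4 (rewrite big_ltn; last lia).
  by rewrite big_geq //; lia.
rewrite (split4 _ (feas_a F)) split4; last by move=> j /andP[].
apply: leq_add; last first.
  rewrite big_nat_cond big1 // => j; rewrite andbT => /andP[ij _].
  by case aj: (a j) => //; have := feas_aa5 F ij ai aj; rewrite (negPf nfr).
have b1 : i.+1 < n -> b i.+1 by move: nfr; rewrite /free_nbr; lia.
(* If [i > 0], then [u'_(i-1)] is in [S], and its visibility from [u_(i+1)], [u_(i+2)] and [u_(i+3)]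
   gives these constraints. If [i = 0], the bound [5 <= n] puts the whole window inside the path
   instead. *)
have edge : i = 0 \/ [/\ ~~ a i.+1, a i.+2 -> (i.+3 < n) && ~~ b i.+3
    & a i.+3 -> ~~ b i.+2 || (i.+4 < n) && ~~ b i.+4].
  have [i0|i0] := posnP i; [by left|right].
  have b0 : b i.-1 by move: nfr; rewrite /free_nbr; lia.
  split.
  - apply/negP=> a1; have /(_ i) := feas_ba2 F _ _ b0 a1; rewrite ai.
    by move=> /(_ ltac:(lia) ltac:(lia)).
  - move=> a2; have /(_ i i.+1) := feas_ba3 F _ _ _ b0 a2.
    rewrite ai /free_nbr /= => /(_ ltac:(lia) ltac:(lia) ltac:(lia)).
    by rewrite orbF; have := feas_a F a2; clear -b1; lia.
  - move=> a3; have := feas_ba4 F _ b0 a3.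
    by rewrite /free_nbr /= => /(_ ltac:(lia)).
have range : [/\ i.+4 < n -> i.+3 < n, i.+3 < n -> i.+2 < n, i.+2 < n -> i.+1 < n
    & i = 0 -> i.+4 < n] by split; lia.
have A1 := @feas_a _ _ _ F i.+1; have A2 := @feas_a _ _ _ F i.+2.
have A3 := @feas_a _ _ _ F i.+3; have A4 := @feas_a _ _ _ F i.+4.
have B1 := @feas_b _ _ _ F i.+1; have B2 := @feas_b _ _ _ F i.+2.
have B3 := @feas_b _ _ _ F i.+3.
have C4 : b i.+4 -> false.
  by move=> b4; rewrite (feas_ab4 F _ ai b4) in nfr.
have C3 : b i.+3 -> ~~ a i.+1 && ~~ a i.+2.
  by move=> b3; have := feas_ab3 F erefl erefl erefl ai b3; rewrite (negPf nfr).
have T1 := @feas_ab2 _ _ _ F i _ _ erefl erefl ai.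
have T2 := @feas_ab2 _ _ _ F i.+1 _ _ erefl erefl.
have T3 := @feas_ba2 _ _ _ F i.+1 _ _ erefl erefl.
have T4 := @feas_ba2 _ _ _ F i.+2 _ _ erefl erefl.
have D1 := @feas_aa2 _ _ _ F i _ _ erefl erefl ai.
have D2 := @feas_aa2 _ _ _ F i.+1 _ _ erefl erefl.
have D3 := @feas_aa2 _ _ _ F i.+2 _ _ erefl erefl.
have E3 := @feas_aa3 _ _ _ F i _ _ _ erefl erefl erefl ai.
have E4 := @feas_aa3 _ _ _ F i.+1 _ _ _ erefl erefl erefl.
rewrite /gap; case: range => r4 r3 r2 r0.
have {r0} edge : i.+4 < n \/ [/\ ~~ a i.+1, a i.+2 -> (i.+3 < n) && ~~ b i.+3
    & a i.+3 -> ~~ b i.+2 || (i.+4 < n) && ~~ b i.+4] by case: edge; auto.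
move: r4 r3 r2 b1 edge A1 A2 A3 A4 B1 B2 B3 C4 C3 T1 T2 T3 T4 D1 D2 D3 E3 E4.
case: (i.+4 < n); case: (i.+3 < n); case: (i.+2 < n); case: (i.+1 < n) => //= [];
  try (by intros; bits).
all: case: (a i.+1); case: (a i.+2) => //=; try (by intros; bits).
all: case: (a i.+3); case: (a i.+4) => //=; try (by intros; bits).
all: case: (b i.+1); case: (b i.+3) => //=; try (by intros; bits).
all: case: (b i.+2); case: (b i.+4) => //=; by intros; bits.
Qed.

Lemma sum_mirror n i (f : nat -> bool) : i <= n ->
  \sum_(n - i <= j < n) mirror n f j = \sum_(0 <= j < i) f j.
Proof.
move=> le_in; rewrite -{1}[n - i]add0n big_addn subKn // big_nat_rev /=.
apply: eq_big_nat => j /andP[_ ltji]; rewrite /mirror.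
have -> : (0 + i - j.+1 + (n - i) < n) by lia.
by congr (nat_of_bool (f _)); lia.
Qed.

Lemma sum_before n a b i : 5 <= n -> feasible n a b -> a i -> ~~ free_nbr n b i ->
  \sum_(0 <= j < i) a j <= \sum_(0 <= j < i) gap n b j.
Proof.
move=> n5 F ai nfr; have lt_in := feas_a F ai.
have le_in := ltnW lt_in.
rewrite -!(sum_mirror _ le_in).
have e : n - i = (n.-1 - i).+1 by lia.
have e' : n.-1 - (n.-1 - i) = i by lia.
have := @sum_after n _ _ (n.-1 - i) n5 (feasible_mirror F).
rewrite free_nbr_mirror ?e' /mirror; last by lia.
rewrite e' ai andbT => /(_ ltac:(lia) nfr).
rewrite e => /leq_trans; apply; rewrite -e.
rewrite leq_eqVlt; apply/orP; left; apply/eqP.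
apply: eq_big_nat => j /andP[_ lt_jn]; rewrite /mirror /gap lt_jn /=.
by have -> : n.-1 - j < n by lia.
Qed.

Lemma sum_feasible n a b : 5 <= n -> feasible n a b ->
  \sum_(0 <= i < n) a i <= \sum_(0 <= i < n) gap n b i + (n + 1) %/ 4.
Proof.
move=> n5 F; have [/forallP fr|] := boolP [forall i : 'I_n, a i ==> free_nbr n b i].
  apply: sum_charged => // i ai.
  exact: (implyP (fr (Ordinal (feas_a F ai)))).
case/forallPn=> -[i lt_in] /=; rewrite negb_imply => /andP[ai nfr].
(* Only [i] itself is left over, and [(n + 1) %/ 4] is at least one. *)
have := leq_add (sum_before n5 F ai nfr) (sum_after n5 F ai nfr).
rewrite (big_cat_nat (leq0n i) (ltnW lt_in)) /= (big_ltn lt_in) ai /=.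
rewrite [X in _ -> _ <= X + _](big_cat_nat (leq0n i) (ltnW lt_in)) /=.
rewrite [X in _ -> _ <= _ + X + _](big_ltn lt_in); lia.
Qed.

(** * Counting in a set that contains [v^*] *)

Lemma sum_window n m (f : nat -> bool) :
  (forall j, f j -> j < n) -> (forall j, f j -> m <= j <= m.+4) ->
  \sum_(0 <= j < n) f j = f m + f m.+1 + f m.+2 + f m.+3 + f m.+4.
Proof.
move=> fn fm; rewrite (sum_nat_widen fn (leq0n n) (N := m.+4.+1 + n)); last lia.
rewrite (@big_cat_nat _ _ _ m) /=; [|lia|lia].
rewrite big_nat_cond big1 => [|j]; last first.
  by rewrite andbT => /andP[_ jm]; case fj: (f j) => //; have := fm _ fj; lia.
rewrite (@big_cat_nat _ _ _ m.+4.+1) /=; [|lia|lia].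
rewrite [X in _ + (_ + X)]big_nat_cond [X in _ + (_ + X)]big1 => [|j]; last first.
  by rewrite andbT => /andP[jm _]; case fj: (f j) => //; have := fm _ fj; lia.
do 5 (rewrite big_ltn; last lia).
by rewrite big_geq //; lia.
Qed.

(* The analogue of [feasible] for a set that contains [v^*]. *)
Record apex_feasible n a b : Prop := ApexFeasible {
  apex_a : forall i, a i -> i < n;
  apex_b : forall i, b i -> i < n;
  apex_aa3 : forall i, a i -> a i.+3 ->
    [|| ~~ a i.+1 && ~~ a i.+2, ~~ b i.+1 && ~~ a i.+2 | ~~ a i.+1 && ~~ b i.+2];
  apex_aa4 : forall i, a i -> a i.+4 -> ~~ a i.+2 || (~~ a i.+1 && ~~ a i.+3);
  apex_aa5 : forall i j, a i -> a j -> j <= i.+4;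
  apex_ab2 : forall i, a i -> b i.+2 -> ~~ a i.+1;
  apex_ab4 : forall i j, a i -> b j -> (i <= j.+3) && (j <= i.+3);
  apex_bb : forall i j, b i -> b j -> i < j -> j = i.+2 }.

(** [B] has at most two elements, by [apex_bb], and [A] lies in the five indices starting at its
    minimum [m]. If [B] is nonempty, [A] has at most three elements. *)
Lemma sum_apex_feasible n a b : apex_feasible n a b ->
  \sum_(0 <= i < n) a i + \sum_(0 <= i < n) b i <= 5.
Proof.
move=> F.
have min (f : nat -> bool) : (forall j, f j -> j < n) ->
    \sum_(0 <= j < n) f j = 0 \/ exists2 m, f m & forall j, f j -> m <= j.
  move=> fn; have [/existsP ex|/existsPn nex] := boolP [exists i : 'I_n, f i].
    have ex' : exists k, f k by case: ex => i fi; exists i.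
    by right; exists (ex_minn ex'); case: ex_minnP.
  left; rewrite big_nat_cond big1 // => j; rewrite andbT => /andP[_ lt_jn].
  by rewrite (negPf (nex (Ordinal lt_jn))).
have le2 : \sum_(0 <= i < n) b i <= 2.
  have [-> //|[k bk kmin]] := min b (apex_b F).
  have near j : b j -> j = k \/ j = k.+2.
    move=> bj; have := kmin j bj; rewrite leq_eqVlt => /orP[/eqP->|]; first by left.
    by move/(apex_bb F bk bj); right.
  rewrite (sum_window (m := k) (apex_b F)); last by move=> j /near; lia.
  have := near k.+1; have := near k.+3; have := near k.+4.
  by case: (b k.+1); case: (b k.+3); case: (b k.+4) => //; lia.
have [->|[m am mmin]] := min a (apex_a F); first by lia.
rewrite (sum_window (m := m) (apex_a F)); last first.
  by move=> j aj; rewrite mmin // (apex_aa5 F am aj).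
have [b0|[j bj _]] := min b (apex_b F).
  have := apex_aa3 F am; have := apex_aa4 F am.
  by case: (a m.+1); case: (a m.+2); case: (a m.+3); case: (a m.+4) => //=; lia.
(* Four [a]'s would be [m, m+1, m+3, m+4], which leaves no room for [j]. *)
suff : a m + a m.+1 + a m.+2 + a m.+3 + a m.+4 <= 3 by lia.
have b1 := apex_ab4 F am bj; have b2 := apex_ab4 F (i := m.+4) _ bj.
have jE : a m.+4 -> [\/ j = m.+1, j = m.+2 | j = m.+3].
  by move=> a4; have := b2 a4; case: (j =P m.+1) => [|?]; [by constructor|];
     case: (j =P m.+2) => [|?]; [by constructor| constructor 3; lia].
have := apex_aa3 F am; have := apex_aa4 F am; have := apex_aa3 F (i := m.+1).
have := apex_ab2 F am.
case a1: (a m.+1); case a2: (a m.+2); case a3: (a m.+3); case a4: (a m.+4) => //=;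
  rewrite ?am ?andbF ?orbF //; try (by move=> _ _ _ /(_ isT));
  try by move=> _ _ /(_ isT).
(* The pairs [u_m, u'_(m+2)], then [u_(m+1), u_(m+4)], then [u_m, u_(m+3)] exclude [m.+2], [m.+3]
   and [m.+1] from [B]. *)
move=> b2' /(_ isT isT) b3' _ /(_ isT) b1'.
by case: (jE a4) bj b1' b2' b3' => -> -> // _ /(_ isT).
Qed.
End Combinatorics.

(** * Visibility at distance at most four *)

(** Any walk contains a simple path, so its length bounds that of the witness. Visibility at small
    distance thus becomes an enumeration of short sequences. *)
Lemma visible_walk (H : sgraph) (S : {set H}) x y q :
    visible S x y -> path (@adj H) x q -> last x q = y ->
  exists p, [/\ path (@adj H) x p, last x p = y, size p <= size q
              & all [predC S] (internal x p)].
Proof.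
case/visibleP=> p [/shortest_pathP[/and3P[xp /eqP lp _] min_p] pS] xq lq.
case: (shortenP xq) lq => q' xq' uq' sub lq'.
exists p; split=> //; last by apply/allP=> z /pS.
apply: leq_trans (min_p q' _) _; first by rewrite /is_path xq' lq' eqxx.
exact: uniq_leq_size (proj2 (andP uq')) sub.
Qed.

Section ShortVisibility.
Variables (H : sgraph) (S : {set H}) (x y : H).
Hypothesis vis : visible S x y.
Hypothesis neq_xy : x <> y.
Hypothesis nadj_xy : ~~ adj x y.

Lemma visible_dist2 k : adj x k -> adj k y ->
  exists z, [/\ adj x z, adj z y & z \notin S].
Proof.
move=> xk ky; have [||p [pp lp sp pS]] := visible_walk (q := [:: k; y]) vis.
- by rewrite /= xk ky.
- by [].
case: p pp lp sp pS => [_ //|z [/= /andP[xz _] e|w [] //=]].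
  by move: nadj_xy; rewrite -e xz.
by case/and3P=> xz zw _ e _ /andP[zS _]; exists z; rewrite -e.
Qed.

Hypothesis far2 : forall z, adj x z -> ~~ adj z y.

Lemma visible_dist3 k l : adj x k -> adj k l -> adj l y ->
  exists z w, [/\ adj x z, adj z w, adj w y, z \notin S & w \notin S].
Proof.
move=> xk kl ly; have [||p [pp lp sp pS]] := visible_walk (q := [:: k; l; y]) vis.
- by rewrite /= xk kl ly.
- by [].
case: p pp lp sp pS => [_ //|z [/= /andP[xz _] e|w [|t [] //=]]].
- by move: nadj_xy; rewrite -e xz.
- by case/and3P=> xz zw _ /= e; have := far2 xz; rewrite -e zw.
by case/and4P=> xz zw wt _ e _ /and3P[zS wS _]; exists z, w; rewrite -e.
Qed.

Hypothesis far3 : forall z w, adj x z -> adj z w -> ~~ adj w y.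

Lemma visible_dist4 k l m : adj x k -> adj k l -> adj l m -> adj m y ->
  exists z w t, [/\ adj x z, adj z w, adj w t & adj t y] /\
    [/\ z \notin S, w \notin S & t \notin S].
Proof.
move=> xk kl lm my.
have [||p [pp lp sp pS]] := visible_walk (q := [:: k; l; m; y]) vis.
- by rewrite /= xk kl lm my.
- by [].
case: p pp lp sp pS => [_ //|z [/= /andP[xz _] e|w [|t [|s [] //=]]]].
- by move: nadj_xy; rewrite -e xz.
- by case/and3P=> xz zw _ /= e; have := far2 xz; rewrite -e zw.
- by case/and4P=> xz zw wt _ /= e; have := far3 xz zw; rewrite -e wt.
case/and5P=> xz zw wt ts _ e _ /and4P[zS wS tS _].
by exists z, w, t; rewrite -e.
Qed.

End ShortVisibility.

(** * Sufficient conditions for visibility *)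

Section VisibilityIntro.
Variables (H : sgraph) (S : {set H}).
Implicit Types x y z w t : H.

Lemma is_path_rev x y p : is_path x y p -> is_path y x (rev (belast x p)).
Proof.
case/and3P=> xp /eqP lp up; apply/and3P; split.
- by rewrite -lp rev_path; apply: sub_path xp => u v; rewrite adj_sym.
- by case: p lp {xp up} => [<- //|z p] _; rewrite /= rev_cons last_rcons.
- by rewrite -lp -rev_rcons -lastI rev_uniq.
Qed.

Lemma visible_sym x y : visible S x y -> visible S y x.
Proof.
case/visibleP=> p [/shortest_pathP[xyp min_p] pS]; apply/visibleP.
exists (rev (belast x p)); split.
  apply/shortest_pathP; split=> [|q yxq]; first exact: is_path_rev.
  rewrite size_rev size_belast; have := min_p _ (is_path_rev yxq).
  by rewrite size_rev size_belast.
case/lastP: p pS {xyp min_p} => [|p t] //; rewrite /internal belast_rcons /= => pS z.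
by rewrite rev_cons belast_rcons /= mem_rev => /pS.
Qed.

Lemma visible_walkI x y q : path (@adj H) x q -> last x q = y -> uniq (x :: q) ->
    all [predC S] (internal x q) ->
    (forall p, path (@adj H) x p -> last x p = y -> size q <= size p) ->
  visible S x y.
Proof.
move=> xq lq uq /allP qS min_q; apply/visibleP; exists q; split; last by move=> z /qS.
apply/shortest_pathP; split; first by rewrite /is_path xq lq eqxx.
by move=> p /and3P[xp /eqP lp _]; apply: min_q.
Qed.

Lemma adj_neq x y : adj x y -> x != y.
Proof. by apply: contraTneq => ->; rewrite adj_irr. Qed.

Lemma visible_adj x y : adj x y -> visible S x y.
Proof.
move=> xy; have nxy := adj_neq xy.
apply: (@visible_walkI _ _ [:: y]) => //=; rewrite ?xy ?inE ?nxy //.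
by case=> //= _ e; rewrite e eqxx in nxy.
Qed.

Variables x y : H.
Hypothesis neq_xy : x != y.
Hypothesis nadj_xy : ~~ adj x y.

Lemma visible_via1 z : adj x z -> adj z y -> z \notin S -> visible S x y.
Proof.
move=> xz zy zS; apply: (@visible_walkI _ _ [:: z; y]) => //=; rewrite ?xz ?zy ?zS //.
  by rewrite !inE negb_or neq_xy !adj_neq.
case=> [|u [|v p]] //= => [_ e|/andP[xu _] e].
  by move: neq_xy; rewrite e eqxx.
by move: nadj_xy; rewrite -e xu.
Qed.

Hypothesis far2 : forall z, adj x z -> ~~ adj z y.

Lemma visible_via2 z w : adj x z -> adj z w -> adj w y ->
  z \notin S -> w \notin S -> visible S x y.
Proof.
move=> xz zw wy zS wS; apply: (@visible_walkI _ _ [:: z; w; y]) => //=.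
- by rewrite xz zw wy.
- have xw : x != w by apply: contraNneq nadj_xy => ->.
  have zy : z != y by apply: contraNneq nadj_xy => <-.
  by rewrite !inE !negb_or neq_xy xw zy !adj_neq.
- by rewrite zS wS.
case=> [|u [|v [|? p]]] //= => [_ e|/andP[xu _] e|/and3P[xu uv _] e].
- by move: neq_xy; rewrite e eqxx.
- by move: nadj_xy; rewrite -e xu.
- by have := far2 xu; rewrite -e uv.
Qed.

Hypothesis far3 : forall z w, adj x z -> adj z w -> ~~ adj w y.

Lemma visible_via3 z w t : adj x z -> adj z w -> adj w t -> adj t y ->
  z \notin S -> w \notin S -> t \notin S -> visible S x y.
Proof.
move=> xz zw wt ty zS wS tS; apply: (@visible_walkI _ _ [:: z; w; t; y]) => //=.
- by rewrite xz zw wt ty.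
- have xw : x != w by apply: contraTneq ty => e; apply: far2; rewrite e.
  have xt : x != t by apply: contraNneq nadj_xy => ->.
  have zt : z != t by apply: contraTneq ty => <-; apply: far2.
  have zy : z != y by apply: contraNneq nadj_xy => <-.
  have wy : w != y by apply: contraTneq zw => ->; apply: far2.
  by rewrite !inE !negb_or neq_xy xw xt zt zy wy !adj_neq.
- by rewrite zS wS tS.
case=> [|u [|v [|s [|? p]]]] //=
  => [_ e|/andP[xu _] e|/and3P[xu uv _] e|/and4P[xu uv vs _] e].
- by move: neq_xy; rewrite e eqxx.
- by move: nadj_xy; rewrite -e xu.
- by have := far2 xu; rewrite -e uv.
- by have := far3 xu uv; rewrite -e vs.
Qed.
End VisibilityIntro.

(** * Mutual-visibility sets of the Mycielskian of a path *)

Section PathMycielskian.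
Variable n : nat.
Local Notation M := (mycielskian (path_graph n)).
Implicit Types i j k l m : 'I_n.

Definition orig i : M := inl (inl i).
Definition copy i : M := inl (inr i).
Definition apex : M := inr tt.

Variable S : {set M}.

(** The default [false] outside the path turns a set of ordinals into a predicate on [nat], where
    shifted indices need no range proofs. *)
Definition trace (f : 'I_n -> M) (k : nat) : bool :=
  oapp (fun i => f i \in S) false (insub k).
Local Notation a := (trace orig).
Local Notation b := (trace copy).

Lemma traceE f i : trace f i = (f i \in S).
Proof. by rewrite /trace valK. Qed.

Lemma traceP f (k : nat) : trace f k -> exists2 i : 'I_n, k = i & f i \in S.
Proof. by rewrite /trace; case: insubP => //= i _ <-; exists i. Qed.

Lemma trace_lt f (k : nat) : trace f k -> k < n.
Proof. by case/traceP=> i ->. Qed.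

Lemma card_trace : #|S| = \sum_(0 <= i < n) a i + \sum_(0 <= i < n) b i + (apex \in S).
Proof.
rewrite -sum1_card big_mkcond big_sumType /= big_sumType /= !big_mkord.
congr (_ + _ + _).
- by apply: eq_bigr => i _; rewrite traceE; case: ifP.
- by apply: eq_bigr => i _; rewrite traceE; case: ifP.
- by rewrite (big_pred1 tt) => [|[]] //; case: ifP.
Qed.

Lemma free_nbrI i k : path_adj i k -> copy k \notin S -> free_nbr n b i.
Proof.
rewrite -traceE /path_adj /free_nbr => /orP[] /eqP e bk.
  by rewrite e ltn_ord bk orbT.
by rewrite -e /= bk.
Qed.

Lemma path_nbr i : 1 < n -> exists k, path_adj i k.
Proof.
move=> n1; rewrite /path_adj; have [lt_in|le_ni] := ltnP i.+1 n.
  by exists (Ordinal lt_in); rewrite /= eqxx.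
have lt_in : i.-1 < n by have := ltn_ord i; lia.
by exists (Ordinal lt_in); rewrite /=; have := ltn_ord i; lia.
Qed.

Lemma visible_orig2 i k j :
    k = i.+1 :> nat -> j = i.+2 :> nat -> visible S (orig i) (orig j) ->
  ~~ a k || ~~ b k.
Proof.
move=> ik ij vis.
have [| |||[[z|z]|[]] [//= iz zj zS]] := visible_dist2 vis _ _ (k := orig k).
- by case=> e; move: ij; rewrite e; lia.
- by rewrite /= /path_adj; lia.
- by rewrite /= /path_adj; lia.
- by rewrite /= /path_adj; lia.
- have <- : z = k by apply: val_inj; move: iz zj; rewrite /= /path_adj; lia.
  by rewrite !traceE zS.
- have <- : z = k by apply: val_inj; move: iz zj; rewrite /= /path_adj; lia.
  by rewrite !traceE zS orbT.
Qed.

(** The route through [v^*] has length four, hence is too long. The internal vertices lie over [k]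
    and [l], and they are not both copies because copies are pairwise nonadjacent. *)
Lemma visible_orig3 i k l j :
    k = i.+1 :> nat -> l = i.+2 :> nat -> j = i.+3 :> nat ->
    visible S (orig i) (orig j) ->
  [|| ~~ a k && ~~ a l, ~~ b k && ~~ a l | ~~ a k && ~~ b l].
Proof.
move=> ik il ij vis.
have [| |||||z [w]] := visible_dist3 vis _ _ _ (k := orig k) (l := orig l).
- by case=> e; move: ij; rewrite e; lia.
- by rewrite /= /path_adj; lia.
- by case=> [[z|z]|[]]; rewrite /= /path_adj; lia.
- by rewrite /= /path_adj; lia.
- by rewrite /= /path_adj; lia.
- by rewrite /= /path_adj; lia.
case: z w => [[z|z]|[]] [[w|w]|[]] [//= iz zw wj zS wS];
  have ez : z = k by apply: val_inj; move: iz zw wj; rewrite /= /path_adj; lia.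
all: have ew : w = l by apply: val_inj; move: iz zw wj; rewrite /= /path_adj; lia.
all: by subst z w; rewrite !traceE zS wS ?orbT.
Qed.

(** With [v^*] blocked, a shortest path runs over [k], [l], [m] and has no two consecutive copies:
    it uses [u_l], or else both [u_k] and [u_m]. *)
Lemma visible_orig4 i k l m j :
    apex \in S -> k = i.+1 :> nat -> l = i.+2 :> nat -> m = i.+3 :> nat ->
    j = i.+4 :> nat -> visible S (orig i) (orig j) ->
  ~~ a l || (~~ a k && ~~ a m).
Proof.
move=> vS ik il im ij vis.
have [| |||||||z [w [t]]] := visible_dist4 vis _ _ _ _ (k := orig k) (l := orig l) (m := orig m).
- by case=> e; move: ij; rewrite e; lia.
- by rewrite /= /path_adj; lia.
- by case=> [[z|z]|[]]; rewrite /= /path_adj; lia.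
- by case=> [[z|z]|[]] [[w|w]|[]]; rewrite /= /path_adj; lia.
- by rewrite /= /path_adj; lia.
- by rewrite /= /path_adj; lia.
- by rewrite /= /path_adj; lia.
- by rewrite /= /path_adj; lia.
case: z w t => [[z|z]|[]] [[w|w]|[]] [[t|t]|[]] [[//= iz zw wt tj] [zS wS tS]].
all: try by rewrite vS in wS.
all: have ez : z = k by apply: val_inj; move: iz zw wt tj; rewrite /= /path_adj; lia.
all: have ew : w = l by apply: val_inj; move: iz zw wt tj; rewrite /= /path_adj; lia.
all: have et : t = m by apply: val_inj; move: iz zw wt tj; rewrite /= /path_adj; lia.
all: by subst z w t; rewrite !traceE ?zS ?wS ?tS ?orbT.
Qed.

(** At this separation every shortest path has length four and the form
    [u_i, u'_z, v^*, u'_t, u_j]. *)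
Lemma visible_orig_far i j : 1 < n -> i.+4 < j -> visible S (orig i) (orig j) ->
  [&& apex \notin S, free_nbr n b i & free_nbr n b j].
Proof.
move=> n1 ij vis; have [k ik] := path_nbr i n1; have [m jm] := path_nbr j n1.
have [| |||||||z [w [t]]] := visible_dist4 vis _ _ _ _ (k := copy k) (l := apex) (m := copy m).
- by case=> e; move: ij; rewrite e; lia.
- by rewrite /= /path_adj; lia.
- by case=> [[z|z]|[]]; rewrite /= /path_adj; lia.
- by case=> [[z|z]|[]] [[w|w]|[]]; rewrite /= /path_adj; lia.
- by [].
- by [].
- by [].
- by rewrite /= path_adj_sym.
case: z w t => [[z|z]|[]] [[w|w]|[]] [[t|t]|[]] [[//= iz zw wt tj] [zS wS tS]].
all: try by move: iz zw wt tj; rewrite /path_adj; lia.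
by rewrite wS (free_nbrI iz zS) (@free_nbrI j t) // path_adj_sym.
Qed.

Lemma visible_orig_copy2 i k j : path_adj i k -> path_adj k j -> i <> j ->
  visible S (orig i) (copy j) -> ~~ a k.
Proof.
move=> ik kj ij vis.
have [| |||[[z|z]|[]] [//= iz zj zS]] := visible_dist2 vis _ _ (k := orig k).
- by [].
- have nij : (i : nat) <> j by move/val_inj.
  by move: ik kj; rewrite /= /path_adj; lia.
- by [].
- by [].
have nij : (i : nat) <> j by move/val_inj.
have <- : z = k by apply: val_inj; move: ik kj iz zj; rewrite /= /path_adj; lia.
by rewrite traceE.
Qed.

(** The vertex before [u'_j] is [v^*], reached through the copy of any neighbour of [i], or it is
    [u_l], reached through [u_k] or [u'_k]. *)
Lemma visible_orig_copy3 i k l j : path_adj i k -> path_adj k l -> path_adj l j ->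
    (i.+3 == j) || (j.+3 == i) -> visible S (orig i) (copy j) ->
  (apex \notin S) && free_nbr n b i || ~~ a l && (~~ a k || ~~ b k).
Proof.
move=> ik kl lj ij vis.
have [| |||||z [w]] := visible_dist3 vis _ _ _ (k := orig k) (l := orig l).
- by [].
- by move: ij; rewrite /= /path_adj; lia.
- by case=> [[z|z]|[]]; move: ij; rewrite /= /path_adj; lia.
- by [].
- by [].
- by [].
case: z w => [[z|z]|[]] [[w|w]|[]] [//= iz zw wj zS wS]; last first.
  by rewrite wS (free_nbrI iz zS).
all: have ez : z = k by apply: val_inj; move: ik kl lj ij iz zw wj; rewrite /= /path_adj; lia.
all: have ew : w = l by apply: val_inj; move: ik kl lj ij iz zw wj; rewrite /= /path_adj; lia.
all: by subst z w; rewrite !traceE zS wS ?orbT.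
Qed.

Lemma visible_orig_copy_far i j : 1 < n -> (i.+3 < j) || (j.+3 < i) ->
  visible S (orig i) (copy j) -> (apex \notin S) && free_nbr n b i.
Proof.
move=> n1 ij vis; have [k ik] := path_nbr i n1.
have [| |||||z [w]] := visible_dist3 vis _ _ _ (k := copy k) (l := apex).
- by [].
- by move: ij; rewrite /= /path_adj; lia.
- by case=> [[z|z]|[]]; move: ij; rewrite /= /path_adj; lia.
- by [].
- by [].
- by [].
case: z w => [[z|z]|[]] [[w|w]|[]] [//= iz zw wj zS wS]; last first.
  by rewrite wS (free_nbrI iz zS).
all: by move: ij iz zw wj; rewrite /= /path_adj; lia.
Qed.

Lemma visible_copy i j : i < j -> visible S (copy i) (copy j) ->
  (apex \notin S) || (j == i.+2 :> nat).
Proof.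
move=> ij vis.
have [| |||[[z|z]|[]] [//= iz zj zS]] := visible_dist2 vis _ _ (k := apex).
- by case=> e; move: ij; rewrite e; lia.
- by [].
- by [].
- by [].
- by move: iz zj; rewrite /path_adj; lia.
- by rewrite zS.
Qed.

Hypothesis mvS : mutual_visibility S.

Lemma mutual_visible x y : x \in S -> y \in S -> x != y -> visible S x y.
Proof.
move=> xS yS; have /forallP/(_ x)/implyP/(_ xS) := mvS.
by move/forallP/(_ y)/implyP/(_ yS)/implyP; apply.
Qed.

Lemma trace_visible_orig (i j : 'I_n) :
  a i -> a j -> i != j :> nat -> visible S (orig i) (orig j).
Proof. by rewrite !traceE => ? ? ij; apply: mutual_visible. Qed.

Lemma trace_visible_mixed (i j : 'I_n) : a i -> b j -> visible S (orig i) (copy j).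
Proof. by rewrite !traceE => ? ?; apply: mutual_visible. Qed.

Lemma trace_visible_copy (i j : 'I_n) :
  b i -> b j -> i != j :> nat -> visible S (copy i) (copy j).
Proof. by rewrite !traceE => ? ? ij; apply: mutual_visible. Qed.

Lemma trace_feasible : 1 < n -> apex \notin S -> feasible n a b.
Proof.
move=> n1 vS; split; try exact: trace_lt.
- move=> i k j -> -> ai aj ak.
  have := @visible_orig2 (Ordinal (trace_lt ai)) (Ordinal (trace_lt ak))
    (Ordinal (trace_lt aj)) erefl erefl.
  by rewrite /= ak; apply; apply: trace_visible_orig => //=; lia.
- move=> i k l j -> -> -> ai aj; have lj := trace_lt aj.
  have [li lk ll] : [/\ i < n, i.+1 < n & i.+2 < n] by split; lia.
  apply: (@visible_orig3 (Ordinal li) (Ordinal lk) (Ordinal ll) (Ordinal lj)) => //.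
  by apply: trace_visible_orig => //=; lia.
- move=> i j ij ai aj.
  have := @visible_orig_far (Ordinal (trace_lt ai)) (Ordinal (trace_lt aj)) n1 ij.
  by rewrite vS; apply; apply: trace_visible_orig => //=; lia.
- move=> i k j -> -> ai bj; have lj := trace_lt bj.
  have [li lk] : i < n /\ i.+1 < n by lia.
  apply: (@visible_orig_copy2 (Ordinal li) (Ordinal lk) (Ordinal lj)).
  + by rewrite /path_adj /= eqxx.
  + by rewrite /path_adj /= eqxx.
  + by case; lia.
  + exact: trace_visible_mixed.
- move=> i k j -> -> bi aj; have lj := trace_lt aj.
  have [li lk] : i < n /\ i.+1 < n by lia.
  apply: (@visible_orig_copy2 (Ordinal lj) (Ordinal lk) (Ordinal li)).
  + by rewrite /path_adj /= eqxx orbT.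
  + by rewrite /path_adj /= eqxx orbT.
  + by case; lia.
  + exact: trace_visible_mixed.
- move=> i k l j -> -> -> ai bj; have lj := trace_lt bj.
  have [li lk ll] : [/\ i < n, i.+1 < n & i.+2 < n] by split; lia.
  have := @visible_orig_copy3 (Ordinal li) (Ordinal lk) (Ordinal ll) (Ordinal lj).
  rewrite /path_adj /= !eqxx vS => /(_ isT isT isT isT (trace_visible_mixed _ _)).
  rewrite /free_nbr lk => /(_ ai bj).
  by case: (b i.+1); case: (a i.+1); case: (a i.+2);
     rewrite ?orbT ?orbF.
- move=> i k l j -> -> -> bi aj; have lj := trace_lt aj.
  have [li lk ll] : [/\ i < n, i.+1 < n & i.+2 < n] by split; lia.
  have := @visible_orig_copy3 (Ordinal lj) (Ordinal ll) (Ordinal lk) (Ordinal li).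
  rewrite /path_adj /= !eqxx !orbT vS => /(_ isT isT isT isT (trace_visible_mixed _ _)).
  rewrite /free_nbr /= => /(_ aj bi).
  by case: (b i.+2); case: (a i.+1); case: (a i.+2); rewrite ?orbT ?orbF.
- move=> i j ij ai bj.
  have := @visible_orig_copy_far (Ordinal (trace_lt ai)) (Ordinal (trace_lt bj)) n1.
  by rewrite /= ij vS; apply=> //; apply: trace_visible_mixed.
- move=> i j ij bi aj.
  have := @visible_orig_copy_far (Ordinal (trace_lt aj)) (Ordinal (trace_lt bi)) n1.
  by rewrite /= ij orbT vS; apply=> //; apply: trace_visible_mixed.
Qed.

Lemma trace_apex_feasible : 1 < n -> apex \in S -> apex_feasible n a b.
Proof.
move=> n1 vS; split; try exact: trace_lt.
- move=> i ai aj; have lj := trace_lt aj.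
  have [li lk ll] : [/\ i < n, i.+1 < n & i.+2 < n] by split; lia.
  apply: (@visible_orig3 (Ordinal li) (Ordinal lk) (Ordinal ll) (Ordinal lj)) => //.
  by apply: trace_visible_orig => //=; lia.
- move=> i ai aj; have lj := trace_lt aj.
  have [li lk ll lm] : [/\ i < n, i.+1 < n, i.+2 < n & i.+3 < n] by split; lia.
  apply: (@visible_orig4 (Ordinal li) (Ordinal lk) (Ordinal ll) (Ordinal lm)
            (Ordinal lj)) => //.
  by apply: trace_visible_orig => //=; lia.
- move=> i j ai aj; rewrite leqNgt; apply/negP => ij.
  have := @visible_orig_far (Ordinal (trace_lt ai)) (Ordinal (trace_lt aj)) n1 ij.
  rewrite vS /= => h; suff: false by [].
  by apply: h; apply: trace_visible_orig => //=; lia.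
- move=> i ai bj; have lj := trace_lt bj.
  have [li lk] : i < n /\ i.+1 < n by lia.
  apply: (@visible_orig_copy2 (Ordinal li) (Ordinal lk) (Ordinal lj)).
  + by rewrite /path_adj /= eqxx.
  + by rewrite /path_adj /= eqxx.
  + by case; lia.
  + exact: trace_visible_mixed.
- move=> i j ai bj; apply: contraT => ij.
  have := @visible_orig_copy_far (Ordinal (trace_lt ai)) (Ordinal (trace_lt bj)) n1.
  rewrite /= vS; apply; last exact: trace_visible_mixed; lia.
- move=> i j bi bj ij.
  have := @visible_copy (Ordinal (trace_lt bi)) (Ordinal (trace_lt bj)) ij.
  rewrite vS /= => /(_ (trace_visible_copy _ _ _)) h; apply/eqP; apply: h => //=; lia.
Qed.

Lemma card_mutual_visibility : 5 <= n -> #|S| <= n + (n + 1) %/ 4.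
Proof.
move=> n5; rewrite card_trace; have n1 : 1 < n by lia.
have [vS|vS] := boolP (apex \in S).
  (* Five vertices and [v^*] make six, which is the bound at [n = 5]. *)
  have := sum_apex_feasible (trace_apex_feasible n1 vS); lia.
have := sum_feasible n5 (trace_feasible n1 vS).
suff : \sum_(0 <= i < n) b i + \sum_(0 <= i < n) gap n b i = n by lia.
rewrite -big_split /= -[RHS]subn0 -[RHS]muln1 -sum_nat_const_nat.
by apply: eq_big_nat => i /andP[_ ltin]; rewrite /gap ltin; case: (b i).
Qed.
End PathMycielskian.

(** * An extremal set *)

Section Extremal.
Variable n : nat.
Local Notation M := (mycielskian (path_graph n)).
Local Notation orig := (@orig n).
Local Notation copy := (@copy n).
Local Notation apex := (apex n).
Local Notation k := ((n + 1) %/ 4).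
Implicit Types i j m : 'I_n.

Definition block_set : {set M} :=
  [set x : M | match x with
  | inl (inl i) => ~~ odd i && (i < 4 * k)
  | inl (inr i) => ~~ ((i %% 4 == 1) && (i < 4 * k))
  | inr _ => false
  end].

Lemma in_block_orig i : (orig i \in block_set) = ~~ odd i && (i < 4 * k).
Proof. by rewrite inE. Qed.

Lemma in_block_copy i : (copy i \in block_set) = ~~ ((i %% 4 == 1) && (i < 4 * k)).
Proof. by rewrite inE. Qed.

Lemma apex_notin_block : apex \notin block_set.
Proof. by rewrite inE. Qed.

Lemma block_center i : orig i \in block_set ->
  exists m, [/\ path_adj i m, orig m \notin block_set & copy m \notin block_set].
Proof.
rewrite in_block_orig => ik.
(* An even [i] is [4t] or [4t+2], hence adjacent to [4t+1]. As [4t+4 <= 4k <= n+1], this index is in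
   range. *)
have lt_mn : 4 * (i %/ 4) + 1 < n by lia.
by exists (Ordinal lt_mn); rewrite in_block_orig in_block_copy /path_adj /=; split; lia.
Qed.

Lemma block_middle i j : orig i \in block_set -> (i.+2 == j) || (j.+2 == i) ->
  exists m, [/\ path_adj i m, path_adj m j & orig m \notin block_set].
Proof.
rewrite in_block_orig => ik ij.
(* The midpoint is odd because [i] is even, so its original vertex is outside the set. *)
have lt_mn : (i + j) %/ 2 < n by have := ltn_ord i; have := ltn_ord j; lia.
by exists (Ordinal lt_mn); rewrite in_block_orig /path_adj /=; split; lia.
Qed.

Lemma block_visible_orig i j : orig i \in block_set -> orig j \in block_set ->
  i != j -> visible block_set (orig i) (orig j).
Proof.
move=> iS jS ij; have nij : i != j :> nat by [].
have [ei ej] : ~~ odd i /\ ~~ odd j.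
  by move: iS jS; rewrite !in_block_orig => /andP[-> _] /andP[-> _].
have nadj : ~~ @adj M (orig i) (orig j) by rewrite /= /path_adj; lia.
have [near|far] := boolP ((i.+2 == j) || (j.+2 == i)).
  have [m [im mj mS]] := block_middle iS near.
  exact: (visible_via1 _ nadj (z := orig m) im mj mS).
(* Distinct even indices that do not differ by two differ by at least four, so the route of length
   four through [v^*] is shortest. *)
have [m [im _ mS]] := block_center iS; have [l [jl _ lS]] := block_center jS.
apply: (visible_via3 _ nadj _ _ (z := copy m) (w := apex) (t := copy l)) => //.
- by move=> [[z|z]|[]] //=; rewrite /path_adj; lia.
- by move=> [[z|z]|[]] [[w|w]|[]] //=; rewrite /path_adj; lia.
- by rewrite /= path_adj_sym.
- exact: apex_notin_block.
Qed.

Lemma block_visible_mixed i j : orig i \in block_set -> copy j \in block_set ->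
  visible block_set (orig i) (copy j).
Proof.
move=> iS jS.
have [adj_ij|nadj] := boolP (@adj M (orig i) (copy j)); first exact: visible_adj.
have [m [im mS mS']] := block_center iS.
have [eij|/eqP nij] := eqVneq i j.
  apply: (visible_via1 _ nadj (z := orig m)) => //.
  by rewrite /= path_adj_sym -eij.
have {}nij : i <> j :> nat by move/val_inj.
have [near|far] := boolP ((i.+2 == j) || (j.+2 == i)).
  have [l [il lj lS]] := block_middle iS near.
  exact: (visible_via1 _ nadj (z := orig l) il lj lS).
apply: (visible_via2 _ nadj _ (z := copy m) (w := apex)) => //.
- by move: nadj; move=> /= nadj [[z|z]|[]] //=; move: nadj; rewrite /path_adj; lia.
- exact: apex_notin_block.
Qed.

Lemma block_mutual_visibility : mutual_visibility block_set.
Proof.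
apply/forallP => x; apply/implyP => xS; apply/forallP => y; apply/implyP => yS.
apply/implyP; case: x y xS yS => [[i|i]|[]] [[j|j]|[]] xS yS ij.
- exact: block_visible_orig.
- exact: block_visible_mixed.
- by rewrite (negPf apex_notin_block) in yS.
- exact/visible_sym/block_visible_mixed.
- exact: (visible_via1 ij _ (z := apex) _ _ apex_notin_block).
- by rewrite (negPf apex_notin_block) in yS.
all: by rewrite (negPf apex_notin_block) in xS.
Qed.

(** A block of four indices holds two originals and three copies; the three extra indices hold two
    of each. The sum stops there because the last block may lack its fourth index. *)
Lemma sum_blocks K :
  \sum_(0 <= j < 4 * K + 3) (~~ odd j + (j %% 4 != 1)) = 5 * K + 4.
Proof.
elim: K => [|K IH]; first by rewrite !big_nat_recr //= big_geq.
have -> : 4 * K.+1 + 3 = (4 * K + 3).+4 by lia.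
do 4 rewrite big_nat_recr //=.
rewrite IH; lia.
Qed.

Lemma card_block_set : 3 <= n -> n + k <= #|block_set|.
Proof.
move=> n3; rewrite card_trace (negPf apex_notin_block) addn0 -big_split /=.
(* Since [k] is positive, the first [4k-1] indices give [5(k-1)+4 = (4k-1)+k] vertices; each later
   index gives at least its copy. *)
have le_n : 4 * k.-1 + 3 <= n by lia.
rewrite (big_cat_nat (leq0n _) le_n) /=.
apply: (@leq_trans (5 * k.-1 + 4 + (n - (4 * k.-1 + 3)))); first by lia.
apply: leq_add.
  rewrite -sum_blocks; apply: eq_leq; apply: eq_big_nat => j /andP[_ lj].
  have lt_jn : j < n by lia.
  rewrite -[j]/(nat_of_ord (Ordinal lt_jn)) !traceE in_block_orig in_block_copy /=.
  lia.
rewrite -[X in X <= _]muln1 -sum_nat_const_nat !big_nat; apply: leq_sum => j /andP[lj lt_jn].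
rewrite -[j]/(nat_of_ord (Ordinal lt_jn)) !traceE in_block_orig in_block_copy /=.
lia.
Qed.
End Extremal.

Theorem theorem5p1 (n : nat) (hn : 5 <= n) :
  mu (mycielskian (path_graph n)) = n + (n + 1) %/ 4.
Proof.
apply/eqP; rewrite eqn_leq; apply/andP; split.
  by apply/bigmax_leqP => S mvS; apply: card_mutual_visibility.
apply: leq_trans (card_block_set _) _; first by lia.
exact: leq_bigmax_cond (block_mutual_visibility n).
Qed.
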